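(* There is an effective procedure which assigns to each $\Sigma_1$-sentence $\sigma$ of $\mathbb{L}_{\sf a}$ an $\mathbb{L}_{\sf a}$-sentence $[\sigma]$ such that: (1) $[\sigma] \vdash \sigma$; (2) if $\mathbb{N} \models \sigma$, then $\mathsf{R}_0 \vdash [\sigma]$; (3) if $\mathbb{N} \models \neg\sigma$, then $[\sigma] \vdash \mathsf{R}_0$.
   Context: $\mathbb{L}_{\sf a}$ is the first-order signature $\{0, \mathsf{S}, +, \times, \leq\}$ in which $\leq$ is a primitive binary relation symbol. For $n \in \omega$, $\overline{n}$ denotes the numeral $\mathsf{S}\cdots\mathsf{S}0$ with $n$ occurrences of $\mathsf{S}$. $\mathsf{R}_0$ is the $\mathbb{L}_{\sf a}$-theory with axioms, for all $m, n \in \omega$: $\overline{m}+\overline{n} = \overline{m+n}$; $\overline{m}\times\overline{n} = \overline{m\times n}$; $\overline{m} \neq \overline{n}$ if $m \neq n$; $\forall x\,(x \leq \overline{n} \to \bigvee_{i\leq n} x = \overline{i})$; $\overline{m} \leq \overline{n}$ if $m \leq n$. A $\Sigma_1$-formula is one of the form $\exists \vec{x}\,\delta$ with $\delta$ a $\Delta_0$ (bounded-quantifier) formula. $\mathbb{N}$ is the standard model. *)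

(* Defs.v *)
(* First-order arithmetic over Stdlib, in de Bruijn syntax. *)
From Stdlib Require Import Arith List Cantor.

Inductive term : Type :=
| tvar (n : nat)
| tzero
| tsucc (t : term)
| tadd (s t : term)
| tmul (s t : term).

(* [fall] and [fex] bind de Bruijn index 0 of their body. *)
Inductive form : Type :=
| fbot
| feq (s t : term)
| fle (s t : term)
| fimp (phi psi : form)
| fand (phi psi : form)
| for_ (phi psi : form)
| fall (phi : form)
| fex (phi : form).

Definition fneg (phi : form) : form := fimp phi fbot.

Fixpoint subst_term (sg : nat -> term) (t : term) : term :=
  match t with
  | tvar n => sg n
  | tzero => tzero
  | tsucc t => tsucc (subst_term sg t)
  | tadd s t => tadd (subst_term sg s) (subst_term sg t)
  | tmul s t => tmul (subst_term sg s) (subst_term sg t)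
  end.

Definition shift_term : term -> term := subst_term (fun n => tvar (S n)).

Definition scons (t : term) (sg : nat -> term) (n : nat) : term :=
  match n with
  | 0 => t
  | S n => sg n
  end.

Definition up (sg : nat -> term) : nat -> term :=
  scons (tvar 0) (fun n => shift_term (sg n)).

Fixpoint subst (sg : nat -> term) (phi : form) : form :=
  match phi with
  | fbot => fbot
  | feq s t => feq (subst_term sg s) (subst_term sg t)
  | fle s t => fle (subst_term sg s) (subst_term sg t)
  | fimp phi psi => fimp (subst sg phi) (subst sg psi)
  | fand phi psi => fand (subst sg phi) (subst sg psi)
  | for_ phi psi => for_ (subst sg phi) (subst sg psi)
  | fall phi => fall (subst (up sg) phi)
  | fex phi => fex (subst (up sg) phi)
  end.

Definition shift : form -> form := subst (fun n => tvar (S n)).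

Definition inst (t : term) : form -> form := subst (scons t tvar).

(* All free de Bruijn indices are smaller than [k]. *)
Fixpoint bounded_term (k : nat) (t : term) : Prop :=
  match t with
  | tvar n => n < k
  | tzero => True
  | tsucc t => bounded_term k t
  | tadd s t | tmul s t => bounded_term k s /\ bounded_term k t
  end.

Fixpoint bounded (k : nat) (phi : form) : Prop :=
  match phi with
  | fbot => True
  | feq s t | fle s t => bounded_term k s /\ bounded_term k t
  | fimp phi psi | fand phi psi | for_ phi psi => bounded k phi /\ bounded k psi
  | fall phi | fex phi => bounded (S k) phi
  end.

Definition sentence (phi : form) : Prop := bounded 0 phi.

(* Classical natural deduction with equality. *)
Inductive nd : list form -> form -> Prop :=
| nd_ax G phi : In phi G -> nd G phi
| nd_impI G phi psi : nd (phi :: G) psi -> nd G (fimp phi psi)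
| nd_impE G phi psi : nd G (fimp phi psi) -> nd G phi -> nd G psi
| nd_andI G phi psi : nd G phi -> nd G psi -> nd G (fand phi psi)
| nd_andE1 G phi psi : nd G (fand phi psi) -> nd G phi
| nd_andE2 G phi psi : nd G (fand phi psi) -> nd G psi
| nd_orI1 G phi psi : nd G phi -> nd G (for_ phi psi)
| nd_orI2 G phi psi : nd G psi -> nd G (for_ phi psi)
| nd_orE G phi psi chi :
    nd G (for_ phi psi) -> nd (phi :: G) chi -> nd (psi :: G) chi -> nd G chi
| nd_raa G phi : nd (fneg phi :: G) fbot -> nd G phi
| nd_allI G phi : nd (map shift G) phi -> nd G (fall phi)
| nd_allE G phi t : nd G (fall phi) -> nd G (inst t phi)
| nd_exI G phi t : nd G (inst t phi) -> nd G (fex phi)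
| nd_exE G phi psi :
    nd G (fex phi) -> nd (phi :: map shift G) (shift psi) -> nd G psi
| nd_refl G t : nd G (feq t t)
| nd_eqE G phi s t : nd G (feq s t) -> nd G (inst s phi) -> nd G (inst t phi).

Definition theory : Type := form -> Prop.

Definition proves (T : theory) (phi : form) : Prop :=
  exists G : list form, (forall psi, In psi G -> T psi) /\ nd G phi.

Definition proves_theory (T U : theory) : Prop :=
  forall psi, U psi -> proves T psi.

Definition single (phi : form) : theory := fun psi => psi = phi.

Fixpoint num (n : nat) : term :=
  match n with
  | 0 => tzero
  | S n => tsucc (num n)
  end.

(* The disjunction of [F i] over [i <= n], inclusive. *)
Fixpoint big_or (F : nat -> form) (n : nat) : form :=
  match n with
  | 0 => F 0
  | S n => for_ (big_or F n) (F (S n))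
  end.

Inductive R0 : theory :=
| R0_add m n : R0 (feq (tadd (num m) (num n)) (num (m + n)))
| R0_mul m n : R0 (feq (tmul (num m) (num n)) (num (m * n)))
| R0_neq m n : m <> n -> R0 (fneg (feq (num m) (num n)))
| R0_bnd n :
    R0 (fall (fimp (fle (tvar 0) (num n))
                   (big_or (fun i => feq (tvar 0) (num i)) n)))
| R0_le m n : m <= n -> R0 (fle (num m) (num n)).

(* The bound [t] is shifted under the quantifier, so it cannot contain the
   quantified variable. *)
Definition ball (t : term) (phi : form) : form :=
  fall (fimp (fle (tvar 0) (shift_term t)) phi).

Definition bex (t : term) (phi : form) : form :=
  fex (fand (fle (tvar 0) (shift_term t)) phi).

Inductive Delta0 : form -> Prop :=
| D0_bot : Delta0 fbot
| D0_eq s t : Delta0 (feq s t)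
| D0_le s t : Delta0 (fle s t)
| D0_imp phi psi : Delta0 phi -> Delta0 psi -> Delta0 (fimp phi psi)
| D0_and phi psi : Delta0 phi -> Delta0 psi -> Delta0 (fand phi psi)
| D0_or phi psi : Delta0 phi -> Delta0 psi -> Delta0 (for_ phi psi)
| D0_ball t phi : Delta0 phi -> Delta0 (ball t phi)
| D0_bex t phi : Delta0 phi -> Delta0 (bex t phi).

Inductive Sigma1 : form -> Prop :=
| S1_D0 phi : Delta0 phi -> Sigma1 phi
| S1_ex phi : Sigma1 phi -> Sigma1 (fex phi).

Definition Sigma1_sentence (phi : form) : Prop := Sigma1 phi /\ sentence phi.

Definition env_cons (a : nat) (rho : nat -> nat) (n : nat) : nat :=
  match n with
  | 0 => a
  | S n => rho n
  end.

Fixpoint N_eval (rho : nat -> nat) (t : term) : nat :=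
  match t with
  | tvar n => rho n
  | tzero => 0
  | tsucc t => S (N_eval rho t)
  | tadd s t => N_eval rho s + N_eval rho t
  | tmul s t => N_eval rho s * N_eval rho t
  end.

Fixpoint N_sat (rho : nat -> nat) (phi : form) : Prop :=
  match phi with
  | fbot => False
  | feq s t => N_eval rho s = N_eval rho t
  | fle s t => N_eval rho s <= N_eval rho t
  | fimp phi psi => N_sat rho phi -> N_sat rho psi
  | fand phi psi => N_sat rho phi /\ N_sat rho psi
  | for_ phi psi => N_sat rho phi \/ N_sat rho psi
  | fall phi => forall a, N_sat (env_cons a rho) phi
  | fex phi => exists a, N_sat (env_cons a rho) phi
  end.

Definition N_models (phi : form) : Prop := forall rho, N_sat rho phi.

Notation "⟨ a , b ⟩" := (Cantor.to_nat (a, b)) (at level 0).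

(* Indices of the unary partial recursive functions: the closure of zero,
   successor and the projections of the Cantor pairing under pairing,
   composition, primitive recursion and minimisation. Functions of several
   arguments are handled through the pairing. *)
Inductive rec_index : Type :=
| rzero
| rsucc
| rfst
| rsnd
| rpair (f g : rec_index)
| rcomp (f g : rec_index)
| rprec (f g : rec_index)
| rmin (f : rec_index).

(* [rec_graph c n v]: the partial function with index [c] is defined at [n] with
   value [v]. For [h := rprec f g]:
     h⟨a, 0⟩ = f a   and   h⟨a, k + 1⟩ = g⟨a, ⟨k, h⟨a, k⟩⟩⟩.
   [rmin f] maps [a] to the least [v] with f⟨a, v⟩ = 0, provided f⟨a, j⟩ is
   defined for all j < v. *)
Fixpoint rec_graph (c : rec_index) (n v : nat) : Prop :=
  match c with
  | rzero => v = 0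
  | rsucc => v = S n
  | rfst => v = fst (Cantor.of_nat n)
  | rsnd => v = snd (Cantor.of_nat n)
  | rpair f g => exists a b, rec_graph f n a /\ rec_graph g n b /\ v = ⟨a, b⟩
  | rcomp f g => exists m, rec_graph g n m /\ rec_graph f m v
  | rprec f g =>
      let (a, k) := Cantor.of_nat n in
      (fix iter (k v : nat) : Prop :=
         match k with
         | 0 => rec_graph f a v
         | S k => exists w, iter k w /\ rec_graph g ⟨a, ⟨k, w⟩⟩ v
         end) k v
  | rmin f =>
      rec_graph f ⟨n, v⟩ 0 /\
      forall j, j < v -> exists w, rec_graph f ⟨n, j⟩ (S w)
  end.

Fixpoint godel_term (t : term) : nat :=
  match t with
  | tvar n => ⟨0, n⟩
  | tzero => ⟨1, 0⟩
  | tsucc t => ⟨2, godel_term t⟩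
  | tadd s t => ⟨3, ⟨godel_term s, godel_term t⟩⟩
  | tmul s t => ⟨4, ⟨godel_term s, godel_term t⟩⟩
  end.

Fixpoint godel (phi : form) : nat :=
  match phi with
  | fbot => ⟨0, 0⟩
  | feq s t => ⟨1, ⟨godel_term s, godel_term t⟩⟩
  | fle s t => ⟨2, ⟨godel_term s, godel_term t⟩⟩
  | fimp phi psi => ⟨3, ⟨godel phi, godel psi⟩⟩
  | fand phi psi => ⟨4, ⟨godel phi, godel psi⟩⟩
  | for_ phi psi => ⟨5, ⟨godel phi, godel psi⟩⟩
  | fall phi => ⟨6, godel phi⟩
  | fex phi => ⟨7, godel phi⟩
  end.

(* [F] is effective on [D]: some partial recursive function sends the Gödel
   number of each formula in [D] to the Gödel number of its image. *)
Definition effective_on (D : form -> Prop) (F : form -> form) : Prop :=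
  exists c : rec_index,
    forall phi, D phi -> rec_graph c (godel phi) (godel (F phi)).

(* Main.v *)
(* The sentence certifying [sigma], that is [exists x1 .. xm, delta], says: there are [y]
   and [z <= y] such that the arithmetical operations behave correctly up to [y]
   ([certified]), such that [z + 2] can be squared [d] times without exceeding [y]
   ([squares_le d]), and such that [delta] has witnesses bounded by [z].  Here [d] is
   at least the number of function symbols of [delta]; hence every value that matters
   in the evaluation of [delta] at arguments up to [z] is at most [y].

   If [sigma] is true, suitable standard [y] and [z] exist, and [R0] proves every true
   bounded sentence.  Suppose that [sigma] is false.  If [y] is the numeral of [n], then
   the correctness of arithmetic up to [n] suffices to evaluate [delta] and refute the
   certificate.  So [y] differs from all numerals, all of them lie below [y], and
   correctness up to [y] contains every axiom of [R0]. *)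

From Stdlib Require Import Arith List Cantor Lia.
Require Import Defs.
Import ListNotations.

(** * Substitution *)

Lemma subst_term_ext s s' t :
  (forall n, s n = s' n) -> subst_term s t = subst_term s' t.
Proof. intros E; induction t; simpl; congruence. Qed.

Lemma up_ext s s' : (forall n, s n = s' n) -> forall n, up s n = up s' n.
Proof. intros E [|n]; simpl; [|unfold shift_term; rewrite E]; reflexivity. Qed.

Lemma subst_ext phi : forall s s',
  (forall n, s n = s' n) -> subst s phi = subst s' phi.
Proof.
  induction phi; intros sg sg' E; simpl; f_equal; auto using subst_term_ext, up_ext.
Qed.

Lemma subst_term_ext_bounded k s s' t :
  (forall n, n < k -> s n = s' n) -> bounded_term k t ->
  subst_term s t = subst_term s' t.
Proof.
  intros E; induction t; simpl; intros B; try destruct B; f_equal; auto.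
Qed.

Lemma subst_ext_bounded phi : forall k s s',
  (forall n, n < k -> s n = s' n) -> bounded k phi -> subst s phi = subst s' phi.
Proof.
  assert (U : forall k s s', (forall n, n < k -> s n = s' n) ->
    forall n, n < S k -> up s n = up s' n).
  { intros k s s' E [|n] Hn; simpl; [reflexivity|].
    unfold shift_term; rewrite E by lia; reflexivity. }
  induction phi; intros k sg sg' E B; simpl in *; f_equal;
    try destruct B; eauto using subst_term_ext_bounded.
Qed.

Lemma subst_term_comp s s' t :
  subst_term s (subst_term s' t) = subst_term (fun n => subst_term s (s' n)) t.
Proof. induction t; simpl; congruence. Qed.

Lemma subst_comp phi : forall s s',
  subst s (subst s' phi) = subst (fun n => subst_term s (s' n)) phi.
Proof.
  assert (U : forall s s' n,
    subst_term (up s) (up s' n) = up (fun n => subst_term s (s' n)) n).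
  { intros s s' [|n]; simpl; [reflexivity|].
    unfold shift_term; rewrite !subst_term_comp; reflexivity. }
  induction phi; intros sg sg'; simpl; f_equal; auto using subst_term_comp;
    rewrite IHphi; apply subst_ext, U.
Qed.

Lemma subst_term_id t : subst_term tvar t = t.
Proof. induction t; simpl; congruence. Qed.

Lemma inst_shift_term u t : subst_term (scons u tvar) (shift_term t) = t.
Proof. unfold shift_term; rewrite subst_term_comp; apply subst_term_id. Qed.

Lemma subst_id phi : subst tvar phi = phi.
Proof.
  induction phi; simpl; rewrite ?subst_term_id; try congruence;
    f_equal; rewrite <- IHphi at 2; apply subst_ext; intros [|n]; reflexivity.
Qed.

Lemma subst_bounded k s phi :
  (forall n, n < k -> s n = tvar n) -> bounded k phi -> subst s phi = phi.
Proof. intros E B; rewrite <- subst_id; eapply subst_ext_bounded; eauto. Qed.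

Lemma subst_sentence s phi : sentence phi -> subst s phi = phi.
Proof. intros B; apply (subst_bounded 0); [lia|exact B]. Qed.

Lemma bounded_term_mono j k t : j <= k -> bounded_term j t -> bounded_term k t.
Proof. induction t; simpl; intuition lia. Qed.

Lemma bounded_mono phi : forall j k, j <= k -> bounded j phi -> bounded k phi.
Proof.
  induction phi; intros j k L B; simpl in *; auto;
    try (destruct B; split; eauto using bounded_term_mono);
    (eapply IHphi; [|eassumption]; lia).
Qed.

Lemma bounded_num k n : bounded_term k (num n).
Proof. induction n; simpl; auto. Qed.

Lemma subst_num s n : subst_term s (num n) = num n.
Proof. induction n; simpl; congruence. Qed.

Lemma subst_big_or s F n :
  subst s (big_or F n) = big_or (fun i => subst s (F i)) n.
Proof. induction n; simpl; congruence. Qed.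

Lemma bounded_big_or k F n : (forall i, bounded k (F i)) -> bounded k (big_or F n).
Proof. intros H; induction n; simpl; auto. Qed.

Lemma big_or_ext F F' n : (forall i, F i = F' i) -> big_or F n = big_or F' n.
Proof. intros E; induction n; simpl; congruence. Qed.

(** Turns an environment into a closed substitution, so that [N_sat rho phi] can be compared with
    the provability of [subst (nenv rho) phi]. *)
Definition nenv (rho : nat -> nat) (n : nat) : term := num (rho n).

Lemma inst_nenv a rho phi :
  inst (num a) (subst (up (nenv rho)) phi) = subst (nenv (env_cons a rho)) phi.
Proof.
  unfold inst; rewrite subst_comp; apply subst_ext.
  intros [|n]; simpl; unfold nenv, shift_term; rewrite ?subst_num; reflexivity.
Qed.

(** Under a binder [nenv] leaves index 0 as the only variable, so instantiating with the
    eigenvariable changes nothing. *)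
Lemma inst_var_nenv rho phi :
  inst (tvar 0) (subst (up (nenv rho)) phi) = subst (up (nenv rho)) phi.
Proof.
  unfold inst; rewrite subst_comp; apply subst_ext.
  intros [|n]; simpl; unfold nenv, shift_term; rewrite ?subst_num; reflexivity.
Qed.

Lemma shift_up_nenv rho t :
  subst_term (up (nenv rho)) (shift_term t) = subst_term (nenv rho) t.
Proof.
  unfold shift_term; rewrite subst_term_comp; apply subst_term_ext.
  intros n; simpl; unfold nenv, shift_term; apply subst_num.
Qed.

Lemma subst_term_nenv s rho t :
  subst_term s (subst_term (nenv rho) t) = subst_term (nenv rho) t.
Proof.
  rewrite subst_term_comp; apply subst_term_ext; intros n; apply subst_num.
Qed.

Lemma R0_sentence phi : R0 phi -> sentence phi.
Proof.
  intros []; unfold sentence; simpl; repeat split; auto using bounded_num.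
  apply bounded_big_or; intros i; simpl; auto using bounded_num.
Qed.

(** * Natural deduction *)

Lemma nd_weak G phi : nd G phi -> forall G', incl G G' -> nd G' phi.
Proof.
  assert (C : forall (a : form) G G', incl G G' -> incl (a :: G) (a :: G')).
  { intros a G0 G' H x [->|Hx]; [left|right]; auto. }
  assert (M : forall G G', incl G G' -> incl (map shift G) (map shift G'))
    by (intros; apply incl_map; assumption).
  induction 1; intros G' I.
  - apply nd_ax; auto.
  - apply nd_impI; auto.
  - eapply nd_impE; eauto.
  - apply nd_andI; auto.
  - eapply nd_andE1; eauto.
  - eapply nd_andE2; eauto.
  - apply nd_orI1; auto.
  - apply nd_orI2; auto.
  - eapply nd_orE; eauto.
  - apply nd_raa; auto.
  - apply nd_allI; auto.
  - apply nd_allE; auto.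
  - eapply nd_exI; eauto.
  - eapply nd_exE; eauto.
  - apply nd_refl.
  - eapply nd_eqE; eauto.
Qed.

Lemma nd_weak1 G a phi : nd G phi -> nd (a :: G) phi.
Proof. intros H; eapply nd_weak; [exact H|]; apply incl_tl, incl_refl. Qed.

Lemma nd_hyp G a : nd (a :: G) a.
Proof. apply nd_ax; left; reflexivity. Qed.

(** Allows deriving over a small closed context, where eigenvariables cause no trouble, and using
    the result over any other context. *)
Lemma nd_cut G' phi : forall G,
  nd G phi -> (forall psi, In psi G -> nd G' psi) -> nd G' phi.
Proof.
  intros G; revert phi; induction G as [|a G IH]; intros phi H HG.
  - eapply nd_weak; [exact H|intros x []].
  - eapply nd_impE; [|apply HG; left; reflexivity].
    apply IH; [apply nd_impI; exact H|intros; apply HG; right; assumption].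
Qed.

Lemma nd_exfalso G phi : nd G fbot -> nd G phi.
Proof. intros H; apply nd_raa, nd_weak1, H. Qed.

Lemma nd_absurd G phi psi : nd G (fneg phi) -> nd G phi -> nd G psi.
Proof. intros; eapply nd_exfalso, nd_impE; eassumption. Qed.

Lemma nd_contra G phi psi : nd (phi :: G) psi -> nd G (fneg psi) -> nd G (fneg phi).
Proof.
  intros H1 H2; apply nd_impI; eapply nd_impE; [apply nd_weak1, H2|exact H1].
Qed.

Lemma nd_sym G s t : nd G (feq s t) -> nd G (feq t s).
Proof.
  intros H.
  pose proof (nd_eqE G (feq (tvar 0) (shift_term s)) s t H) as E.
  unfold inst in E; simpl in E; rewrite !inst_shift_term in E; apply E, nd_refl.
Qed.

(* Unification cannot find [phi], whose index 0 marks the positions to rewrite, so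
   the two instances are passed as equations. *)
Lemma nd_rewrite G phi s t A B :
  nd G (feq s t) -> inst s phi = A -> inst t phi = B -> nd G A -> nd G B.
Proof. intros H <- <-; apply nd_eqE, H. Qed.

Ltac hole := unfold inst; simpl; rewrite ?inst_shift_term; reflexivity.

Lemma nd_trans G s t u : nd G (feq s t) -> nd G (feq t u) -> nd G (feq s u).
Proof.
  intros H1 H2; apply (nd_rewrite G (feq (shift_term s) (tvar 0)) t u (feq s t)); auto; hole.
Qed.

Lemma nd_succ_cong G s t : nd G (feq s t) -> nd G (feq (tsucc s) (tsucc t)).
Proof.
  intros H; apply (nd_rewrite G (feq (tsucc (shift_term s)) (tsucc (tvar 0))) s t
    (feq (tsucc s) (tsucc s))); auto using nd_refl; hole.
Qed.

Lemma nd_add_cong G s s' t t' :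
  nd G (feq s s') -> nd G (feq t t') -> nd G (feq (tadd s t) (tadd s' t')).
Proof.
  intros H1 H2.
  apply (nd_rewrite G (feq (shift_term (tadd s t)) (tadd (shift_term s') (tvar 0)))
    t t' (feq (tadd s t) (tadd s' t))); auto; [hole|hole|].
  apply (nd_rewrite G (feq (shift_term (tadd s t)) (tadd (tvar 0) (shift_term t)))
    s s' (feq (tadd s t) (tadd s t))); auto using nd_refl; hole.
Qed.

Lemma nd_mul_cong G s s' t t' :
  nd G (feq s s') -> nd G (feq t t') -> nd G (feq (tmul s t) (tmul s' t')).
Proof.
  intros H1 H2.
  apply (nd_rewrite G (feq (shift_term (tmul s t)) (tmul (shift_term s') (tvar 0)))
    t t' (feq (tmul s t) (tmul s' t))); auto; [hole|hole|].
  apply (nd_rewrite G (feq (shift_term (tmul s t)) (tmul (tvar 0) (shift_term t)))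
    s s' (feq (tmul s t) (tmul s t))); auto using nd_refl; hole.
Qed.

Lemma nd_le_cong G s s' t t' :
  nd G (feq s s') -> nd G (feq t t') -> nd G (fle s t) -> nd G (fle s' t').
Proof.
  intros H1 H2 H.
  apply (nd_rewrite G (fle (shift_term s') (tvar 0)) t t' (fle s' t)); auto; [hole|hole|].
  apply (nd_rewrite G (fle (tvar 0) (shift_term t)) s s' (fle s t)); auto; hole.
Qed.

Lemma nd_big_orE F n chi : forall G,
  nd G (big_or F n) -> (forall i, i <= n -> nd (F i :: G) chi) -> nd G chi.
Proof.
  induction n as [|n IH]; simpl; intros G H K.
  - eapply nd_impE; [|exact H]; apply nd_impI, K; lia.
  - eapply nd_orE; [exact H| |apply K; lia].
    apply IH; [apply nd_hyp|].
    intros i Hi; apply nd_weak with (F i :: G); [apply K; lia|].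
    intros x [->|Hx]; [left|right; right]; auto.
Qed.

Lemma map_shift_id G : (forall psi, In psi G -> shift psi = psi) -> map shift G = G.
Proof. intros H; rewrite <- map_id; apply map_ext_in, H. Qed.

Definition num_bound (n : nat) : form :=
  fall (fimp (fle (tvar 0) (num n)) (big_or (fun i => feq (tvar 0) (num i)) n)).

Lemma num_boundE G n t : nd G (num_bound n) -> nd G (fle t (num n)) ->
  nd G (big_or (fun i => feq t (num i)) n).
Proof.
  intros H1 H2; apply nd_allE with (t := t) in H1.
  unfold inst in H1; simpl in H1; rewrite subst_big_or in H1; simpl in H1.
  rewrite subst_num in H1.
  erewrite big_or_ext; [exact (nd_impE _ _ _ H1 H2)|].
  intros i; simpl; rewrite subst_num; reflexivity.
Qed.

(** The bound axiom leaves finitely many numerals for the eigenvariable, and equality carries each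
    instance back to it. The first two conditions hold when [G] is closed and 0 is the only free
    index of [psi]. *)
Lemma nd_ballI G n u psi :
  map shift G = G -> inst (tvar 0) psi = psi -> nd G (num_bound n) ->
  nd G (feq u (num n)) ->
  (forall i, i <= n -> nd G (inst (num i) psi)) ->
  nd G (fall (fimp (fle (tvar 0) u) psi)).
Proof.
  intros HG Hpsi Hb Hu H; apply nd_allI, nd_impI; rewrite HG.
  eapply nd_big_orE with (n := n).
  - apply num_boundE; [apply nd_weak1, Hb|].
    eapply nd_le_cong; [apply nd_refl|apply nd_weak1, Hu|apply nd_hyp].
  - intros i Hi; simpl; rewrite <- Hpsi.
    eapply nd_eqE; [apply nd_sym, nd_hyp|].
    apply nd_weak1, nd_weak1, H, Hi.
Qed.

(** Turns the refutation of a bounded existential into a bounded universal, so that [nd_ballI]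
    treats both quantifiers. *)
Lemma nd_not_ex G A B :
  map shift G = G -> inst (tvar 0) A = A -> inst (tvar 0) B = B ->
  nd G (fall (fimp A (fneg B))) -> nd G (fneg (fex (fand A B))).
Proof.
  intros HG HA HB H; apply nd_impI.
  eapply nd_exE; [apply nd_hyp|].
  change (shift fbot) with fbot; simpl map; rewrite HG.
  pose proof (nd_allE _ _ (tvar 0) H) as H'.
  unfold inst in *; simpl in H'; rewrite HA, HB in H'.
  eapply nd_impE; [eapply nd_impE; [apply nd_weak1, nd_weak1, H'|]|].
  - eapply nd_andE1, nd_hyp.
  - eapply nd_andE2, nd_hyp.
Qed.

(** Finite search stands in for excluded middle, which keeps the decision of bounded formulas
    constructive. *)
Lemma bounded_dichotomy (A B : nat -> Prop) n :
  (forall a, a <= n -> A a \/ B a) ->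
  (forall a, a <= n -> A a) \/ exists a, a <= n /\ B a.
Proof.
  induction n as [|n IH]; intros H.
  - destruct (H 0 ltac:(lia)); [left|right; eauto].
    intros a Ha; replace a with 0 by lia; assumption.
  - destruct IH as [K|(a & Ha & Ka)]; [auto| |right; exists a; auto].
    destruct (H (S n) ltac:(lia)); [left|right; eauto].
    intros a Ha; destruct (Nat.eq_dec a (S n)) as [->|]; [assumption|apply K; lia].
Qed.

(** * Deciding bounded formulas from finitely many facts *)

(* The instances of [R0] in which all numbers, including the value of the sum
   or product, are at most [N]. *)
Record facts (G : list form) (N : nat) : Prop := {
  facts_add a b : a + b <= N -> nd G (feq (tadd (num a) (num b)) (num (a + b)));
  facts_mul a b : a <= N -> b <= N -> a * b <= N ->
    nd G (feq (tmul (num a) (num b)) (num (a * b)));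
  facts_neq a b : a <= N -> b <= N -> a <> b -> nd G (fneg (feq (num a) (num b)));
  facts_bnd n : n <= N -> nd G (num_bound n);
  facts_le a b : a <= b -> b <= N -> nd G (fle (num a) (num b)) }.

(** This is [b ^ (2 ^ k)]. For [b >= 2] it bounds the value of a term with [k] function symbols at
    arguments up to [b]. *)
Fixpoint tower (b k : nat) : nat :=
  match k with
  | 0 => b
  | S k => tower b k * tower b k
  end.

(** Lets the bound on a quantifier's term serve as the base for its body, so that sizes simply add
    up. *)
Lemma tower_add b i j : tower (tower b i) j = tower b (i + j).
Proof.
  induction j as [|j IH]; simpl; [rewrite Nat.add_0_r; reflexivity|].
  rewrite IH, Nat.add_succ_r; reflexivity.
Qed.

Lemma tower_ge b k : 2 <= b -> b <= tower b k.
Proof. intros H; induction k; simpl; nia. Qed.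

Lemma tower_mono b j k : 2 <= b -> j <= k -> tower b j <= tower b k.
Proof.
  intros H L; replace k with (j + (k - j)) by lia; rewrite <- tower_add.
  apply tower_ge; pose proof (tower_ge b j H); lia.
Qed.

(* Only function symbols are counted: each of them at most squares the bound on the values. *)
Fixpoint term_size (t : term) : nat :=
  match t with
  | tvar _ | tzero => 0
  | tsucc t => S (term_size t)
  | tadd s t | tmul s t => S (term_size s + term_size t)
  end.

Fixpoint form_size (phi : form) : nat :=
  match phi with
  | fbot => 0
  | feq s t | fle s t => term_size s + term_size t
  | fimp phi psi | fand phi psi | for_ phi psi => form_size phi + form_size psi
  | fall phi | fex phi => form_size phi
  end.

Lemma term_size_shift t : term_size (shift_term t) = term_size t.
Proof. unfold shift_term; induction t; simpl; congruence. Qed.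

Lemma N_eval_shift a rho t : N_eval (env_cons a rho) (shift_term t) = N_eval rho t.
Proof. unfold shift_term; induction t; simpl; congruence. Qed.

Lemma N_eval_tower b rho t : 2 <= b -> (forall v, rho v <= b) ->
  N_eval rho t <= tower b (term_size t).
Proof.
  intros Hb Hr; induction t; simpl.
  - apply Hr.
  - lia.
  - pose proof (tower_ge b (term_size t) Hb); nia.
  - pose proof (tower_ge b (term_size t1 + term_size t2) Hb).
    pose proof (tower_mono b (term_size t1) (term_size t1 + term_size t2) Hb).
    pose proof (tower_mono b (term_size t2) (term_size t1 + term_size t2) Hb). nia.
  - pose proof (tower_mono b (term_size t1) (term_size t1 + term_size t2) Hb).
    pose proof (tower_mono b (term_size t2) (term_size t1 + term_size t2) Hb).
    apply Nat.mul_le_mono; lia.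
Qed.

(** Each symbol at most squares the bound on the values, so every sum and product met on the way is
    covered by [facts]; the successor of a numeral is already a numeral. *)
Lemma facts_eval G N b rho t : facts G N -> 2 <= b -> (forall v, rho v <= b) ->
  tower b (term_size t) <= N ->
  nd G (feq (subst_term (nenv rho) t) (num (N_eval rho t))).
Proof.
  intros F Hb Hr; induction t as [v| |t IH|s IHs t IHt|s IHs t IHt]; simpl; intros L.
  - apply nd_refl.
  - apply nd_refl.
  - apply nd_succ_cong, IH.
    pose proof (tower_ge b (term_size t) Hb); nia.
  - pose proof (N_eval_tower b rho (tadd s t) Hb Hr) as E; simpl in E.
    pose proof (tower_ge b (term_size s + term_size t) Hb).
    pose proof (tower_mono b (term_size s) (term_size s + term_size t) Hb).
    pose proof (tower_mono b (term_size t) (term_size s + term_size t) Hb).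
    eapply nd_trans; [apply nd_add_cong; [apply IHs|apply IHt]; nia|].
    apply (facts_add G N F); lia.
  - pose proof (N_eval_tower b rho (tmul s t) Hb Hr) as E; simpl in E.
    pose proof (tower_ge b (term_size s + term_size t) Hb).
    pose proof (tower_mono b (term_size s) (term_size s + term_size t) Hb).
    pose proof (tower_mono b (term_size t) (term_size s + term_size t) Hb).
    pose proof (N_eval_tower b rho s Hb Hr).
    pose proof (N_eval_tower b rho t Hb Hr).
    eapply nd_trans; [apply nd_mul_cong; [apply IHs|apply IHt]; nia|].
    apply (facts_mul G N F); nia.
Qed.

(** The bound axiom would make [num a] equal to a numeral up to [b], and all of these differ from
    it. *)
Lemma facts_not_le G N a b : facts G N -> a <= N -> b < a ->
  nd G (fneg (fle (num a) (num b))).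
Proof.
  intros F Ha Hb; apply nd_impI.
  eapply nd_big_orE; [apply num_boundE; [|apply nd_hyp]|].
  - apply nd_weak1, (facts_bnd G N F); lia.
  - intros i Hi; eapply nd_absurd; [|apply nd_hyp].
    apply nd_weak1, nd_weak1, (facts_neq G N F); lia.
Qed.

(** Truth and provability are decided together, by induction on [phi]. The base [b] varies because a
    quantifier raises the bound on the environment. *)
Lemma facts_Delta0 G N phi : map shift G = G -> facts G N -> Delta0 phi ->
  forall b rho, 2 <= b -> (forall v, rho v <= b) -> tower b (form_size phi) <= N ->
  (N_sat rho phi /\ nd G (subst (nenv rho) phi)) \/
  (~ N_sat rho phi /\ nd G (fneg (subst (nenv rho) phi))).
Proof.
  intros HG F D; induction D as [|s t|s t|p q Dp IHp Dq IHq|p q Dp IHp Dq IHq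
    |p q Dp IHp Dq IHq|t p Dp IHp|t p Dp IHp]; intros b rho Hb Hr L.
  1: { right; split; [intros []|apply nd_impI, nd_hyp]. }
  (* Shared preparation for the two bounded quantifiers. The base for the body is [c], which bounds
     the old environment and the value [n] of the bounding term, hence every admissible value of the
     new variable. *)
  6,7: simpl in L; rewrite term_size_shift, <- tower_add in L;
    set (c := tower b (term_size t)) in *;
    assert (Hbc : b <= c) by (apply tower_ge, Hb);
    assert (Hc : 2 <= c) by lia;
    pose proof (tower_ge c (form_size p) Hc);
    pose proof (N_eval_tower b rho t Hb Hr) as Et; fold c in Et;
    assert (Pt := facts_eval G N b rho t F Hb Hr ltac:(fold c; lia));
    set (n := N_eval rho t) in *;
    assert (IH : forall a, a <= n ->
      (N_sat (env_cons a rho) p /\ nd G (subst (nenv (env_cons a rho)) p)) \/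
      (~ N_sat (env_cons a rho) p /\ nd G (fneg (subst (nenv (env_cons a rho)) p))))
      by (intros a Ha; apply (IHp c); auto;
          intros [|v]; simpl; [lia|specialize (Hr v); lia]);
    assert (A : forall a, N_sat (env_cons a rho) (fle (tvar 0) (shift_term t)) <-> a <= n)
      by (intros a; simpl; rewrite N_eval_shift; reflexivity);
    assert (B := facts_bnd G N F n ltac:(lia));
    assert (Le : forall a, a <= n -> nd G (inst (num a) (fle (tvar 0) (subst_term (nenv rho) t))))
      by (intros a Ha; unfold inst; simpl; rewrite subst_term_nenv;
          eapply nd_le_cong; [apply nd_refl|apply nd_sym, Pt|];
          apply (facts_le G N F); lia);
    set (u := subst_term (nenv rho) t) in *.
  1,2: simpl in L;
    pose proof (tower_mono b (term_size s) (term_size s + term_size t) Hb);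
    pose proof (tower_mono b (term_size t) (term_size s + term_size t) Hb);
    pose proof (N_eval_tower b rho s Hb Hr); pose proof (N_eval_tower b rho t Hb Hr);
    assert (Es := facts_eval G N b rho s F Hb Hr ltac:(lia));
    assert (Et := facts_eval G N b rho t F Hb Hr ltac:(lia)); simpl.
  - destruct (Nat.eq_dec (N_eval rho s) (N_eval rho t)) as [E|E]; [left|right]; split; auto.
    + rewrite E in Es; eapply nd_trans; [exact Es|apply nd_sym, Et].
    + eapply nd_contra; [|apply (facts_neq G N F) with (3 := E); lia].
      eapply nd_trans; [apply nd_sym, nd_weak1, Es|].
      eapply nd_trans; [apply nd_hyp|apply nd_weak1, Et].
  - destruct (le_lt_dec (N_eval rho s) (N_eval rho t)) as [E|E]; [left|right]; split; auto; try lia.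
    + eapply nd_le_cong; [apply nd_sym, Es|apply nd_sym, Et|].
      apply (facts_le G N F); lia.
    + eapply nd_contra; [|apply (facts_not_le G N) with (3 := E); auto; lia].
      eapply nd_le_cong; [apply nd_weak1, Es|apply nd_weak1, Et|apply nd_hyp].
  - simpl in L.
    pose proof (tower_mono b (form_size p) (form_size p + form_size q) Hb).
    pose proof (tower_mono b (form_size q) (form_size p + form_size q) Hb).
    destruct (IHp b rho Hb Hr ltac:(lia)) as [[Sp Pp]|[Sp Pp]];
    destruct (IHq b rho Hb Hr ltac:(lia)) as [[Sq Pq]|[Sq Pq]]; simpl.
    + left; split; [tauto|apply nd_impI, nd_weak1, Pq].
    + right; split; [tauto|].
      eapply nd_contra; [|exact Pq]; eapply nd_impE; [apply nd_hyp|apply nd_weak1, Pp].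
    + left; split; [tauto|apply nd_impI, nd_weak1, Pq].
    + left; split; [tauto|].
      apply nd_impI; eapply nd_absurd; [apply nd_weak1, Pp|apply nd_hyp].
  - simpl in L.
    pose proof (tower_mono b (form_size p) (form_size p + form_size q) Hb).
    pose proof (tower_mono b (form_size q) (form_size p + form_size q) Hb).
    destruct (IHp b rho Hb Hr ltac:(lia)) as [[Sp Pp]|[Sp Pp]];
    [destruct (IHq b rho Hb Hr ltac:(lia)) as [[Sq Pq]|[Sq Pq]]|]; simpl.
    + left; split; [tauto|apply nd_andI; assumption].
    + right; split; [tauto|]; eapply nd_contra; [eapply nd_andE2, nd_hyp|exact Pq].
    + right; split; [tauto|]; eapply nd_contra; [eapply nd_andE1, nd_hyp|exact Pp].
  - simpl in L.
    pose proof (tower_mono b (form_size p) (form_size p + form_size q) Hb).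
    pose proof (tower_mono b (form_size q) (form_size p + form_size q) Hb).
    destruct (IHp b rho Hb Hr ltac:(lia)) as [[Sp Pp]|[Sp Pp]];
    [|destruct (IHq b rho Hb Hr ltac:(lia)) as [[Sq Pq]|[Sq Pq]]]; simpl.
    + left; split; [tauto|apply nd_orI1; assumption].
    + left; split; [tauto|apply nd_orI2; assumption].
    + right; split; [tauto|]; apply nd_impI.
      eapply nd_orE; [apply nd_hyp| |]; (eapply nd_impE; [|apply nd_hyp]);
        do 2 apply nd_weak1; assumption.
  - replace (subst (nenv rho) (ball t p))
      with (fall (fimp (fle (tvar 0) u) (subst (up (nenv rho)) p)))
      by (simpl; rewrite shift_up_nenv; reflexivity).
    destruct (bounded_dichotomy _ _ n IH) as [K|(a & Ha & Sa & Pa)]; [left|right]; split.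
    + intros a Ha; apply K, A, Ha.
    + apply nd_ballI with n; auto using inst_var_nenv.
      intros i Hi; rewrite inst_nenv; apply K, Hi.
    + intros K; apply Sa, K, A, Ha.
    + eapply nd_contra; [|exact Pa].
      rewrite <- inst_nenv.
      eapply nd_impE; [|apply nd_weak1, (Le a Ha)].
      exact (nd_allE _ _ (num a) (nd_hyp G _)).
  - replace (subst (nenv rho) (bex t p))
      with (fex (fand (fle (tvar 0) u) (subst (up (nenv rho)) p)))
      by (simpl; rewrite shift_up_nenv; reflexivity).
    (* With the disjuncts swapped, the search is for a true instance instead of a false one. *)
    assert (IH' := fun a Ha => proj1 (or_comm _ _) (IH a Ha)).
    destruct (bounded_dichotomy _ _ n IH') as [K|(a & Ha & Sa & Pa)]; [right|left]; split.
    + intros (a & Ha & Sa); apply (K a); [apply A, Ha|exact Sa].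
    + apply nd_not_ex; auto using inst_var_nenv.
      { unfold inst, u; simpl; rewrite subst_term_nenv; reflexivity. }
      apply nd_ballI with n; auto.
      * exact (inst_var_nenv rho (fneg p)).
      * intros i Hi.
        change (nd G (fneg (inst (num i) (subst (up (nenv rho)) p)))).
        rewrite inst_nenv; apply K, Hi.
    + exists a; split; [apply A, Ha|exact Sa].
    + apply nd_exI with (num a).
      apply nd_andI; [exact (Le a Ha)|].
      change (nd G (inst (num a) (subst (up (nenv rho)) p))); rewrite inst_nenv; exact Pa.
Qed.

(** * Certified bounds *)

(* Here index 2 is the certified bound [y], and indices 1 and 0 are [x, u <= y]. *)
Definition certified_pair : form :=
  fand (fimp (feq (tsucc (tvar 1)) (tsucc (tvar 0))) (feq (tvar 1) (tvar 0)))
  (fand (feq (tadd (tvar 1) (tsucc (tvar 0))) (tsucc (tadd (tvar 1) (tvar 0))))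
  (fand (feq (tmul (tvar 1) (tsucc (tvar 0))) (tadd (tmul (tvar 1) (tvar 0)) (tvar 1)))
  (fand (fimp (fle (tadd (tvar 1) (tsucc (tvar 0))) (tvar 2))
              (fle (tadd (tvar 1) (tvar 0)) (tvar 2)))
        (fimp (fle (tmul (tvar 1) (tsucc (tvar 0))) (tvar 2))
              (fle (tmul (tvar 1) (tvar 0)) (tvar 2)))))).

(** Index 1 is [y] and index 0 is [x <= y]. The first conjunct lets numerals climb towards [y]; the
    first two [ball] clauses yield the bound axioms and the order by induction outside the
    theory. *)
Definition certified_point : form :=
  fand (for_ (feq (tvar 0) (tvar 1)) (fle (tsucc (tvar 0)) (tvar 1)))
  (fand (fneg (feq (tsucc (tvar 0)) tzero))
  (fand (feq (tadd (tvar 0) tzero) (tvar 0))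
  (fand (feq (tmul (tvar 0) tzero) tzero)
  (fand (fle (tvar 0) (tvar 0))
  (fand (ball (tsucc (tvar 0)) (for_ (fle (tvar 0) (tvar 1)) (feq (tvar 0) (tsucc (tvar 1)))))
  (fand (ball (tvar 0) (fle (tvar 0) (tsucc (tvar 1))))
        (ball (tvar 1) certified_pair))))))).

(** Index 0 is [y]. The second conjunct makes overflow refutable when [y] is a numeral; the third is
    the case 0 of [num_bound]. *)
Definition certified : form :=
  fand (fle tzero (tvar 0))
  (fand (fneg (fle (tsucc (tvar 0)) (tvar 0)))
  (fand (ball tzero (feq (tvar 0) tzero))
        (ball (tvar 0) certified_point))).

Lemma certified_Delta0 : Delta0 certified.
Proof. repeat (unfold fneg; constructor). Qed.

Lemma certified_bounded : bounded 1 certified.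
Proof. simpl; repeat split; lia. Qed.

(** Each clause is true arithmetic at every value of [y], so the choice of [y] stays free. *)
Lemma certified_true rho : N_sat rho certified.
Proof.
  simpl; repeat split; intros; try lia; try nia.
Qed.

Lemma nd_ballE G s t phi r :
  nd G (subst s (ball t phi)) -> nd G (fle r (subst_term s t)) ->
  nd G (subst (scons r s) phi).
Proof.
  intros H Hr.
  assert (E1 : subst_term (scons r tvar) (subst_term (up s) (shift_term t)) = subst_term s t).
  { unfold shift_term; rewrite !subst_term_comp; apply subst_term_ext; intros n; simpl.
    apply inst_shift_term. }
  assert (E2 : subst (scons r tvar) (subst (up s) phi) = subst (scons r s) phi).
  { rewrite subst_comp; apply subst_ext; intros [|n]; simpl; auto using inst_shift_term. }
  rewrite <- E1 in Hr; rewrite <- E2.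
  exact (nd_impE _ _ _ (nd_allE _ _ r H) Hr).
Qed.

(** * Arithmetic of the numerals below an arbitrary certified term *)

Section Certified.

Variables (G : list form) (y : term) (N : nat).
Hypothesis certified_y : nd G (inst y certified).
Hypothesis N_le_y : forall k, k <= N -> nd G (fle (num k) y).

Let env1 k := scons (num k) (scons y tvar).
Let env2 k l := scons (num l) (env1 k).

Lemma certified_at_point k : k <= N -> nd G (subst (env1 k) certified_point).
Proof.
  intros Hk; apply nd_ballE with (t := tvar 0); [|apply N_le_y, Hk].
  exact (nd_andE2 _ _ _ (nd_andE2 _ _ _ (nd_andE2 _ _ _ certified_y))).
Qed.

Lemma certified_at_pair k l : k <= N -> l <= N -> nd G (subst (env2 k l) certified_pair).
Proof.
  intros Hk Hl; apply nd_ballE with (t := tvar 1); [|apply N_le_y, Hl].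
  pose proof (certified_at_point k Hk) as H; unfold certified_point in H.
  simpl subst in H; do 7 apply nd_andE2 in H; exact H.
Qed.

Lemma certified_next k : k <= N ->
  nd G (for_ (feq (num k) y) (fle (num (S k)) y)).
Proof. intros Hk; exact (nd_andE1 _ _ _ (certified_at_point k Hk)). Qed.

(** External induction: [certified_point] at [k] splits [v <= S k] into [v <= k] and [v = S k]. *)
Lemma certified_bnd k : k <= N -> nd G (num_bound k).
Proof.
  induction k as [|k IH]; intros Hk.
  - exact (nd_andE1 _ _ _ (nd_andE2 _ _ _ (nd_andE2 _ _ _ certified_y))).
  - pose proof (certified_at_point k ltac:(lia)) as H; unfold certified_point in H.
    do 5 apply nd_andE2 in H; apply nd_andE1 in H; simpl in H.
    unfold shift_term in H; rewrite !subst_num in H.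
    set (A := fall _) in H.
    (* [G] may have free variables and change under [shift], so the generalisation is done over two
       closed sentences. *)
    apply nd_cut with [A; num_bound k].
    + apply nd_allI, nd_impI.
      rewrite map_shift_id.
      2: { intros p [<-|[<-|[]]]; apply subst_sentence; [|apply R0_sentence, R0_bnd].
           unfold A, sentence; simpl; repeat split; auto using bounded_num; lia. }
      eapply nd_orE.
      * eapply nd_impE; [|apply nd_hyp].
        pose proof (nd_allE [A; num_bound k] _ (tvar 0) (nd_hyp _ _)) as K.
        unfold inst in K; simpl in K; rewrite !subst_num in K.
        apply nd_weak1, K.
      * apply nd_orI1, num_boundE; [|apply nd_hyp].
        apply nd_ax; simpl; auto.
      * apply nd_orI2, nd_hyp.
    + intros p [<-|[<-|[]]]; [exact H|apply IH; lia].
Qed.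

Lemma certified_le a b : a <= b -> b <= N -> nd G (fle (num a) (num b)).
Proof.
  induction 1 as [|b L IH]; intros Hb.
  - pose proof (certified_at_point a Hb) as H.
    do 4 apply nd_andE2 in H; apply nd_andE1 in H; exact H.
  - pose proof (certified_at_point b ltac:(lia)) as H; unfold certified_point in H.
    do 6 apply nd_andE2 in H; apply nd_andE1 in H.
    exact (nd_ballE G (env1 b) (tvar 0) (fle (tvar 0) (tsucc (tvar 1))) (num a) H
      (IH ltac:(lia))).
Qed.

Lemma certified_neq a : forall b, a <= N -> b <= N -> a <> b ->
  nd G (fneg (feq (num a) (num b))).
Proof.
  assert (Z : forall k, S k <= N -> nd G (fneg (feq (num (S k)) (num 0)))).
  { intros k Hk; pose proof (certified_at_point k ltac:(lia)) as H.
    apply nd_andE2, nd_andE1 in H; exact H. }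
  induction a as [|a IH]; intros [|b] Ha Hb E.
  - lia.
  - eapply nd_contra; [apply nd_sym, nd_hyp|apply Z, Hb].
  - apply Z, Ha.
  - eapply nd_contra; [|apply (IH b); lia].
    pose proof (certified_at_pair a b ltac:(lia) ltac:(lia)) as H.
    apply nd_andE1 in H.
    eapply nd_impE; [apply nd_weak1, H|apply nd_hyp].
Qed.

(** The recursion clauses bound the arguments and not the sum; [certified_add_not_le] relies on this
    to evaluate a sum equal to [S n]. *)
Lemma certified_add_num a b : a <= N -> b <= N ->
  nd G (feq (tadd (num a) (num b)) (num (a + b))).
Proof.
  intros Ha; induction b as [|b IH]; intros Hb.
  - rewrite Nat.add_0_r; pose proof (certified_at_point a Ha) as H.
    do 2 apply nd_andE2 in H; apply nd_andE1 in H; exact H.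
  - pose proof (certified_at_pair a b Ha ltac:(lia)) as H.
    apply nd_andE2, nd_andE1 in H.
    rewrite Nat.add_succ_r; eapply nd_trans; [exact H|].
    apply nd_succ_cong, IH; lia.
Qed.

Lemma certified_mul_succ a b : a <= N -> b <= N ->
  nd G (feq (tmul (num a) (num (S b))) (tadd (tmul (num a) (num b)) (num a))).
Proof.
  intros Ha Hb; pose proof (certified_at_pair a b Ha Hb) as H.
  do 2 apply nd_andE2 in H; apply nd_andE1 in H; exact H.
Qed.

Lemma certified_mul_num a b : a <= N -> b <= N -> a * b <= N ->
  nd G (feq (tmul (num a) (num b)) (num (a * b))).
Proof.
  intros Ha; induction b as [|b IH]; intros Hb Hab.
  - rewrite Nat.mul_0_r; pose proof (certified_at_point a Ha) as H.
    do 3 apply nd_andE2 in H; apply nd_andE1 in H; exact H.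
  - rewrite Nat.mul_succ_r in *.
    eapply nd_trans; [apply certified_mul_succ; lia|].
    eapply nd_trans; [apply nd_add_cong; [apply IH; lia|apply nd_refl]|].
    apply certified_add_num; lia.
Qed.

Lemma certified_facts : facts G N.
Proof.
  split; auto using certified_mul_num, certified_neq, certified_bnd, certified_le.
  intros; apply certified_add_num; lia.
Qed.

End Certified.

(** * Overflow beyond a certified numeral *)

Section CertifiedNumeral.

Variables (G : list form) (n : nat).
Hypothesis certified_n : nd G (inst (num n) certified).
Hypothesis le_n : forall k, k <= n -> nd G (fle (num k) (num n)).

Lemma certified_succ_not_le : nd G (fneg (fle (num (S n)) (num n))).
Proof. exact (nd_andE1 _ _ _ (nd_andE2 _ _ _ certified_n)). Qed.

(** The first sum past [n] is exactly [S n], which the certificate excludes; later sums follow by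
    contraposing the clause [x + S u <= y -> x + u <= y]. *)
Lemma certified_add_not_le a b : a <= n -> b <= n -> n < a + b ->
  nd G (fneg (fle (tadd (num a) (num b)) (num n))).
Proof.
  intros Ha; induction b as [|b IH]; intros Hb L; [lia|].
  pose proof (certified_at_pair G (num n) n certified_n le_n a b Ha ltac:(lia)) as H.
  destruct (le_lt_dec (a + b) n) as [E|E].
  - eapply nd_contra; [|apply certified_succ_not_le].
    eapply nd_le_cong; [|apply nd_refl|apply nd_hyp].
    replace (S n) with (a + S b) by lia; apply nd_weak1.
    eapply certified_add_num; eauto.
  - eapply nd_contra; [|apply IH; lia].
    do 3 apply nd_andE2 in H; apply nd_andE1 in H.
    eapply nd_impE; [apply nd_weak1, H|apply nd_hyp].
Qed.

(** As for sums, except that the first product past [n] is an overflowing sum of two numbers up to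
    [n]. *)
Lemma certified_mul_not_le a b : a <= n -> b <= n -> n < a * b ->
  nd G (fneg (fle (tmul (num a) (num b)) (num n))).
Proof.
  intros Ha; induction b as [|b IH]; intros Hb L; [lia|].
  pose proof (certified_at_pair G (num n) n certified_n le_n a b Ha ltac:(lia)) as H.
  destruct (le_lt_dec (a * b) n) as [E|E].
  - eapply nd_contra; [|apply (certified_add_not_le (a * b) a); nia].
    eapply nd_le_cong; [|apply nd_refl|apply nd_hyp].
    apply nd_weak1; eapply nd_trans.
    + eapply certified_mul_succ; eauto; lia.
    + apply nd_add_cong; [|apply nd_refl].
      eapply certified_mul_num; eauto; lia.
  - eapply nd_contra; [|apply IH; lia].
    do 4 apply nd_andE2 in H.
    eapply nd_impE; [apply nd_weak1, H|apply nd_hyp].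
Qed.

End CertifiedNumeral.

(** Starting from [0 <= y], each use of [certified_next] either identifies [y] with a numeral or
    climbs one step. Contexts grow because every disjunction adds a hypothesis. *)
Lemma certified_cases y N chi : forall G, nd G (inst y certified) ->
  (forall n G', n < N -> incl G G' -> (forall k, k <= n -> nd G' (fle (num k) y)) ->
     nd G' (feq y (num n)) -> nd G' chi) ->
  (forall G', incl G G' -> (forall k, k <= N -> nd G' (fle (num k) y)) -> nd G' chi) ->
  nd G chi.
Proof.
  intros G HC; induction N as [|N IH]; intros Hn HN.
  - apply HN; [apply incl_refl|]; intros k Hk; replace k with 0 by lia.
    exact (nd_andE1 _ _ _ HC).
  - apply IH; [intros n G' L; apply (Hn n); lia|].
    intros G' I K.
    assert (HC' : nd G' (inst y certified)) by (eapply nd_weak; eauto).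
    eapply nd_orE; [exact (certified_next G' y N HC' K N (le_n N))| |].
    + apply (Hn N); auto using incl_tl, nd_weak1, nd_sym, nd_hyp.
    + apply HN; [auto using incl_tl|].
      intros k Hk; destruct (Nat.eq_dec k (S N)) as [->|]; [apply nd_hyp|].
      apply nd_weak1, K; lia.
Qed.

(** * A finite part of [R0] that provides the facts up to [N] *)

Definition R0_context (N : nat) : list form :=
  flat_map (fun a => flat_map (fun b =>
    [feq (tadd (num a) (num b)) (num (a + b)); feq (tmul (num a) (num b)) (num (a * b));
     num_bound a]
    ++ (if a =? b then [] else [fneg (feq (num a) (num b))])
    ++ (if a <=? b then [fle (num a) (num b)] else [])) (seq 0 (S N))) (seq 0 (S N)).

Lemma R0_context_incl N phi : In phi (R0_context N) -> R0 phi.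
Proof.
  unfold R0_context; intros (a & _ & H)%in_flat_map; apply in_flat_map in H.
  destruct H as (b & _ & H).
  apply in_app_or in H; destruct H as [[<-|[<-|[<-|[]]]]|H]; try constructor.
  apply in_app_or in H; destruct H as [H|H].
  - destruct (Nat.eqb_spec a b); [destruct H|]; destruct H as [<-|[]]; constructor; auto.
  - destruct (Nat.leb_spec a b); [|destruct H]; destruct H as [<-|[]]; constructor; auto.
Qed.

Lemma R0_context_facts N : facts (R0_context N) N.
Proof.
  assert (I : forall a b phi, a <= N -> b <= N ->
    In phi ([feq (tadd (num a) (num b)) (num (a + b)); feq (tmul (num a) (num b)) (num (a * b));
       num_bound a]
      ++ (if a =? b then [] else [fneg (feq (num a) (num b))])
      ++ (if a <=? b then [fle (num a) (num b)] else [])) -> nd (R0_context N) phi).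
  { intros a b phi Ha Hb H; apply nd_ax; unfold R0_context.
    apply in_flat_map; exists a; split; [apply in_seq; lia|].
    apply in_flat_map; exists b; split; [apply in_seq; lia|exact H]. }
  split.
  - intros a b H; apply (I a b); simpl; auto; lia.
  - intros a b Ha Hb H; apply (I a b); simpl; auto; lia.
  - intros a b Ha Hb H; apply (I a b); auto; apply Nat.eqb_neq in H; rewrite H; simpl; auto.
  - intros a Ha; apply (I a a); simpl; auto.
  - intros a b H Hb; apply (I a b); auto; [lia|].
    apply Nat.leb_le in H; rewrite H; apply in_or_app; right; apply in_or_app; right; left; reflexivity.
Qed.

(** * The certified sentence *)

Fixpoint matrix (phi : form) : form :=
  match phi with
  | fex phi => matrix phi
  | _ => phi
  end.

Fixpoint prefix (phi : form) : nat :=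
  match phi with
  | fex phi => S (prefix phi)
  | _ => 0
  end.

Fixpoint ex_n (m : nat) (phi : form) : form :=
  match m with
  | 0 => phi
  | S m => ex_n m (fex phi)
  end.

(* All [m] quantifiers are bounded by the same variable, which has index 0
   outside of [bex_n m phi] and index [m] in [phi]. *)
Fixpoint bex_n (m : nat) (phi : form) : form :=
  match m with
  | 0 => phi
  | S m => bex_n m (bex (tvar m) phi)
  end.

(** Denotes [(z + 2) ^ (2 ^ d)], that is [tower (z + 2) d], where index 0 is [z]. *)
Fixpoint square_term (d : nat) : term :=
  match d with
  | 0 => tsucc (tsucc (tvar 0))
  | S d => tmul (square_term d) (square_term d)
  end.

(** Index 0 is [z] and index 1 is [y]. All intermediate inequalities are listed so that the first
    overflow can be refuted; [S z <= y] is among them because for [z = y] the certificate refutes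
    [S y <= y] directly, but not [S (S y) <= y]. *)
Fixpoint squares_le (d : nat) : form :=
  match d with
  | 0 => fand (fle (tsucc (tvar 0)) (tvar 1)) (fle (square_term 0) (tvar 1))
  | S d => fand (squares_le d) (fle (square_term (S d)) (tvar 1))
  end.

(* [godel sigma] serves only as a computable bound on [form_size sigma]. *)
Definition cert_body (sigma : form) : form :=
  fand (squares_le (godel sigma)) (bex_n (prefix sigma) (matrix sigma)).

Definition cert_matrix (sigma : form) : form :=
  fand certified (bex (tvar 0) (cert_body sigma)).

Definition cert (sigma : form) : form := fex (cert_matrix sigma).

Lemma ex_n_fex m phi : ex_n m (fex phi) = fex (ex_n m phi).
Proof. revert phi; induction m as [|m IH]; intros phi; simpl; auto. Qed.

Lemma ex_n_matrix phi : ex_n (prefix phi) (matrix phi) = phi.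
Proof. induction phi; simpl; auto; rewrite ex_n_fex; congruence. Qed.

(** A leading bounded existential is itself an [fex] and is stripped too; what remains is a
    conjunction of bounded formulas. *)
Lemma matrix_Delta0 phi : Sigma1 phi -> Delta0 (matrix phi).
Proof.
  induction 1 as [phi []|]; simpl; auto; constructor; auto; constructor.
Qed.

Lemma matrix_bounded phi : forall k, bounded k phi -> bounded (prefix phi + k) (matrix phi).
Proof.
  induction phi; intros k B; simpl; auto.
  rewrite <- Nat.add_succ_r; apply IHphi, B.
Qed.

Lemma matrix_size phi : form_size (matrix phi) = form_size phi.
Proof. induction phi; simpl; auto. Qed.

Lemma bex_n_Delta0 m : forall phi, Delta0 phi -> Delta0 (bex_n m phi).
Proof. induction m; simpl; auto using Delta0. Qed.

Lemma bex_n_bounded m : forall phi, bounded (S m) phi -> bounded 1 (bex_n m phi).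
Proof.
  induction m as [|m IH]; intros phi B; simpl; auto.
  apply IH; simpl; repeat split; auto; lia.
Qed.

Lemma bex_n_size m : forall phi, form_size (bex_n m phi) = form_size phi.
Proof. induction m as [|m IH]; intros phi; simpl; auto; rewrite IH; reflexivity. Qed.

Lemma nd_ex_mono phi psi : nd [phi] psi -> nd [fex phi] (fex psi).
Proof.
  intros H; eapply nd_exE; [apply nd_hyp|].
  apply nd_exI with (tvar 0).
  assert (E : inst (tvar 0) (subst (up (fun n => tvar (S n))) psi) = psi).
  { unfold inst; rewrite subst_comp, <- subst_id; apply subst_ext.
    intros [|n]; reflexivity. }
  change (nd [phi; shift (fex phi)] (inst (tvar 0) (subst (up (fun n => tvar (S n))) psi))).
  rewrite E; eapply nd_weak; [exact H|].
  intros x [->|[]]; left; reflexivity.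
Qed.

Lemma bex_n_ex_n m : forall phi psi, nd [phi] psi -> nd [bex_n m phi] (ex_n m psi).
Proof.
  induction m as [|m IH]; intros phi psi H; simpl; auto.
  apply IH, nd_ex_mono.
  apply nd_cut with [phi]; [exact H|].
  intros x [<-|[]]; eapply nd_andE2, nd_hyp.
Qed.

Fixpoint env_app (xs : list nat) (rho : nat -> nat) : nat -> nat :=
  match xs with
  | [] => rho
  | x :: xs => env_cons x (env_app xs rho)
  end.

Lemma env_app_length xs rho : env_app xs rho (length xs) = rho 0.
Proof. induction xs; simpl; auto. Qed.

Lemma env_app_lt xs rho rho' n : n < length xs -> env_app xs rho n = env_app xs rho' n.
Proof.
  revert n; induction xs as [|x xs IH]; simpl; [lia|].
  intros [|n] Hn; simpl; auto; apply IH; lia.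
Qed.

Lemma N_sat_ex_n m rho : forall phi, N_sat rho (ex_n m phi) <->
  exists xs, length xs = m /\ N_sat (env_app xs rho) phi.
Proof.
  induction m as [|m IH]; intros phi; simpl.
  - split; [exists []; auto|intros ([|] & L & H); [exact H|discriminate]].
  - rewrite IH; split.
    + intros (xs & L & a & H); exists (a :: xs); simpl; auto.
    + intros ([|a xs] & L & H); [discriminate|].
      exists xs; split; [auto|exists a; exact H].
Qed.

Lemma N_sat_bex_n m rho : forall phi, N_sat rho (bex_n m phi) <->
  exists xs, length xs = m /\ (forall x, In x xs -> x <= rho 0) /\ N_sat (env_app xs rho) phi.
Proof.
  induction m as [|m IH]; intros phi.
  - split; [exists []; simpl; intuition|intros ([|] & L & _ & H); [exact H|discriminate]].
  - simpl bex_n; rewrite IH; split.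
    + intros (xs & L & B & a & Ha & H); exists (a :: xs); simpl; repeat split; auto.
      simpl in Ha; rewrite <- L, env_app_length in Ha.
      intros x [<-|Hx]; auto.
    + intros ([|a xs] & L & B & H); [discriminate|].
      injection L as L.
      exists xs; repeat split; auto; [intros; apply B; right; assumption|].
      exists a; split; [|exact H].
      simpl; rewrite <- L, env_app_length; apply B; left; reflexivity.
Qed.

Lemma N_eval_ext k rho rho' t : (forall n, n < k -> rho n = rho' n) ->
  bounded_term k t -> N_eval rho t = N_eval rho' t.
Proof. intros E; induction t; simpl; intros B; try destruct B; f_equal; auto. Qed.

Lemma N_sat_ext phi : forall k rho rho', (forall n, n < k -> rho n = rho' n) ->
  bounded k phi -> N_sat rho phi <-> N_sat rho' phi.
Proof.
  assert (U : forall k rho rho' a, (forall n, n < k -> rho n = rho' n) ->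
    forall n, n < S k -> env_cons a rho n = env_cons a rho' n).
  { intros k rho rho' a E [|n] Hn; simpl; auto; apply E; lia. }
  induction phi as [|s t|s t|p IHp q IHq|p IHp q IHq|p IHp q IHq|p IH|p IH];
    intros k rho rho' E B; simpl in B |- *.
  - tauto.
  - rewrite (N_eval_ext k rho rho' s), (N_eval_ext k rho rho' t); tauto.
  - rewrite (N_eval_ext k rho rho' s), (N_eval_ext k rho rho' t); tauto.
  - rewrite (IHp k rho rho'), (IHq k rho rho'); tauto.
  - rewrite (IHp k rho rho'), (IHq k rho rho'); tauto.
  - rewrite (IHp k rho rho'), (IHq k rho rho'); tauto.
  - split; intros H a; [rewrite <- (IH (S k)); eauto|rewrite (IH (S k)); eauto].
  - split; intros [a H]; exists a; [rewrite <- (IH (S k)); eauto|rewrite (IH (S k)); eauto].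
Qed.

Lemma square_term_bounded d : bounded_term 1 (square_term d).
Proof. induction d; simpl; auto. Qed.

Lemma squares_le_bounded d : bounded 2 (squares_le d).
Proof.
  induction d as [|d IH]; simpl; repeat split; auto; eapply bounded_term_mono;
    [|apply square_term_bounded| |apply square_term_bounded]; lia.
Qed.

Lemma squares_le_Delta0 d : Delta0 (squares_le d).
Proof. induction d; simpl; auto using Delta0. Qed.

Lemma N_eval_square_term rho d : N_eval rho (square_term d) = tower (S (S (rho 0))) d.
Proof. induction d; simpl; congruence. Qed.

(** In the standard model the last inequality implies the others, by monotonicity of [tower]. *)
Lemma N_sat_squares_le rho d :
  N_sat rho (squares_le d) <-> tower (S (S (rho 0))) d <= rho 1.
Proof.
  induction d as [|d IH]; simpl squares_le.
  - simpl; lia.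
  - change (N_sat rho (squares_le d) /\
      N_eval rho (square_term (S d)) <= rho 1 <-> tower (S (S (rho 0))) (S d) <= rho 1).
    rewrite IH, N_eval_square_term.
    pose proof (tower_mono (S (S (rho 0))) d (S d) ltac:(lia) ltac:(lia)); lia.
Qed.

(** Cantor pairing dominates the sum of its components, and the positive tag pays for the function
    symbol. *)
Lemma term_size_godel t : term_size t <= godel_term t.
Proof.
  induction t as [v| |t IH|s IHs t IHt|s IHs t IHt]; cbn [term_size godel_term];
    try lia.
  - pose proof (Cantor.to_nat_non_decreasing 2 (godel_term t)); lia.
  - pose proof (Cantor.to_nat_non_decreasing 3 (Cantor.to_nat (godel_term s, godel_term t))).
    pose proof (Cantor.to_nat_non_decreasing (godel_term s) (godel_term t)); lia.
  - pose proof (Cantor.to_nat_non_decreasing 4 (Cantor.to_nat (godel_term s, godel_term t))).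
    pose proof (Cantor.to_nat_non_decreasing (godel_term s) (godel_term t)); lia.
Qed.

Lemma form_size_godel phi : form_size phi <= godel phi.
Proof.
  assert (P : forall c a b x y, a <= x -> b <= y ->
    a + b <= Cantor.to_nat (c, Cantor.to_nat (x, y))).
  { intros c a b x y Ha Hb.
    pose proof (Cantor.to_nat_non_decreasing c (Cantor.to_nat (x, y))).
    pose proof (Cantor.to_nat_non_decreasing x y); lia. }
  induction phi; cbn [form_size godel]; auto using term_size_godel, Nat.le_0_l.
  - pose proof (Cantor.to_nat_non_decreasing 6 (godel phi)); lia.
  - pose proof (Cantor.to_nat_non_decreasing 7 (godel phi)); lia.
Qed.

Lemma cert_body_bounded sigma : sentence sigma -> bounded 2 (cert_body sigma).
Proof.
  intros B; split; [apply squares_le_bounded|].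
  apply bounded_mono with 1; [lia|]; apply bex_n_bounded.
  apply bounded_mono with (prefix sigma + 0); [lia|]; apply matrix_bounded, B.
Qed.

Lemma cert_matrix_bounded sigma : sentence sigma -> bounded 1 (cert_matrix sigma).
Proof.
  intros B; split; [apply certified_bounded|].
  split; [simpl; lia|apply cert_body_bounded, B].
Qed.

Lemma cert_matrix_Delta0 sigma : Sigma1 sigma -> Delta0 (cert_matrix sigma).
Proof.
  intros Sg; constructor; [apply certified_Delta0|].
  do 2 constructor; [apply squares_le_Delta0|apply bex_n_Delta0, matrix_Delta0, Sg].
Qed.

(** * The three properties of the certified sentence *)

Lemma cert_implies sigma : sentence sigma -> nd [cert sigma] sigma.
Proof.
  intros B.
  assert (H : nd [cert_body sigma] sigma).
  { rewrite <- (ex_n_matrix sigma) at 2.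
    apply nd_cut with [bex_n (prefix sigma) (matrix sigma)].
    - apply bex_n_ex_n, nd_hyp.
    - intros x [<-|[]]; eapply nd_andE2, nd_hyp. }
  eapply nd_exE; [apply nd_hyp|].
  eapply nd_exE; [eapply nd_andE2, nd_hyp|].
  unfold shift; rewrite !(subst_sentence _ sigma B).
  apply nd_cut with [cert_body sigma]; [exact H|].
  intros x [<-|[]]; eapply nd_andE2, nd_hyp.
Qed.

Lemma cert_true sigma : Sigma1_sentence sigma -> N_models sigma -> proves R0 (cert sigma).
Proof.
  intros [Sg B] T.
  specialize (T (fun _ => 0)); rewrite <- (ex_n_matrix sigma), N_sat_ex_n in T.
  destruct T as (xs & L & T).
  (* [z] bounds all witnesses, and [y] is the last of the required squares of [z + 2]. *)
  set (z := list_max xs).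
  set (y := tower (S (S z)) (godel sigma)).
  pose proof (tower_ge (S (S z)) (godel sigma) ltac:(lia)) as Hy; fold y in Hy.
  set (rho := env_cons y (fun _ => 0)).
  assert (Sat : N_sat rho (cert_matrix sigma)).
  { split; [apply certified_true|].
    exists z; split; [simpl; lia|split].
    - apply N_sat_squares_le; simpl; fold y; lia.
    - apply N_sat_bex_n; exists xs; repeat split; auto.
      + apply Forall_forall, list_max_le; reflexivity.
      + revert T; apply N_sat_ext with (k := prefix sigma + 0); [|apply matrix_bounded, B].
        intros n Hn; apply env_app_lt; lia. }
  (* Enough facts to decide the certificate in the environment [rho], whose values are at most
     [y]. *)
  set (N := tower y (form_size (cert_matrix sigma))).
  assert (C : map shift (R0_context N) = R0_context N).
  { apply map_shift_id; intros psi H; eapply subst_sentence, R0_sentence, R0_context_incl, H. }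
  destruct (facts_Delta0 _ N _ C (R0_context_facts N) (cert_matrix_Delta0 sigma Sg) y rho)
    as [[_ H]|[H _]]; [lia| |apply le_n| |contradiction].
  { intros [|v]; simpl; lia. }
  exists (R0_context N); split; [apply R0_context_incl|].
  apply nd_exI with (num y).
  erewrite subst_ext_bounded in H; [exact H| |apply cert_matrix_bounded, B].
  intros [|n] Hn; [reflexivity|lia].
Qed.

(** As long as the squares stay within [n], they are evaluated; the first one to exceed [n] is a
    product of two numbers up to [n], so [certified_mul_not_le] refutes it. *)
Lemma squares_le_decided G n j d :
  nd G (inst (num n) certified) -> (forall k, k <= n -> nd G (fle (num k) (num n))) ->
  j <= n ->
  let s := nenv (env_cons j (env_cons n (fun _ => 0))) in
  (tower (S (S j)) d <= n /\
   nd G (feq (subst_term s (square_term d)) (num (tower (S (S j)) d)))) \/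
  nd G (fneg (subst s (squares_le d))).
Proof.
  intros C Le Hj s.
  assert (T0 : 2 <= S (S j)) by lia.
  induction d as [|d [[L E]|IH]].
  - destruct (le_lt_dec (S (S j)) n) as [L|L].
    + left; split; [exact L|apply nd_refl].
    (* Here [j] is [n] or [n - 1], and one of the two initial inequalities reads [S n <= n]. *)
    + right; destruct (Nat.eq_dec j n) as [->|].
      * eapply nd_contra; [eapply nd_andE1, nd_hyp|].
        exact (certified_succ_not_le G n C).
      * eapply nd_contra; [eapply nd_andE2, nd_hyp|].
        assert (n = S j) as -> by lia.
        exact (certified_succ_not_le G (S j) C).
  - destruct (le_lt_dec (tower (S (S j)) (S d)) n) as [L'|L']; [left|right].
    + split; [exact L'|].
      eapply nd_trans; [apply nd_mul_cong; exact E|].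
      eapply certified_mul_num; eauto.
    + eapply nd_contra; [eapply nd_andE2, nd_hyp|].
      eapply nd_contra; [|apply (certified_mul_not_le G n C Le _ _ L L L')].
      eapply nd_le_cong; [|apply nd_refl|apply nd_hyp].
      apply nd_weak1; apply nd_mul_cong; exact E.
  - right; eapply nd_contra; [eapply nd_andE1, nd_hyp|exact IH].
Qed.

(** Each candidate [z = j] fails: either a square overflows, or the evaluation of the matrix stays
    within [n] and its falsity is provable. The context is closed, as [nd_ballI] requires. *)
Lemma cert_matrix_refuted sigma n : Sigma1_sentence sigma -> N_models (fneg sigma) ->
  nd (inst (num n) (cert_matrix sigma) :: map (fun k => fle (num k) (num n)) (seq 0 (S n))) fbot.
Proof.
  intros [Sg B] T.
  set (G := _ :: _).
  assert (HG : map shift G = G).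
  { apply map_shift_id; intros p [<-|H].
    - unfold shift, inst; rewrite subst_comp.
      apply subst_ext_bounded with 1; [|apply cert_matrix_bounded, B].
      intros [|k] Hk; [apply subst_num|lia].
    - apply in_map_iff in H; destruct H as (k & <- & _).
      apply subst_sentence; split; apply bounded_num. }
  assert (H : nd G (inst (num n) (cert_matrix sigma))) by apply nd_hyp.
  assert (C : nd G (inst (num n) certified)) by (eapply nd_andE1, H).
  assert (Le : forall k, k <= n -> nd G (fle (num k) (num n))).
  { intros k Hk; apply nd_ax; right; apply in_map_iff.
    exists k; split; [reflexivity|apply in_seq; lia]. }
  assert (F : facts G n) by (eapply certified_facts; eauto).
  set (rho := env_cons n (fun _ => 0)).
  assert (K : nd G (subst (nenv rho) (bex (tvar 0) (cert_body sigma)))).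
  { erewrite subst_ext_bounded; [eapply nd_andE2, H| |apply cert_matrix_bounded, B].
    intros [|k] Hk; [reflexivity|lia]. }
  eapply nd_impE; [|exact K].
  apply nd_not_ex; [exact HG|exact (inst_var_nenv rho (fle (tvar 0) (shift_term (tvar 0))))
    |apply inst_var_nenv|].
  apply nd_ballI with n; [exact HG|exact (inst_var_nenv rho (fneg (cert_body sigma)))
    |apply (facts_bnd G n F), le_n
    |rewrite shift_up_nenv; apply nd_refl|].
  intros j Hj.
  change (nd G (fneg (inst (num j) (subst (up (nenv rho)) (cert_body sigma))))).
  rewrite inst_nenv.
  destruct (squares_le_decided G n j (godel sigma) C Le Hj) as [[L _]|Q].
  - eapply nd_contra; [eapply nd_andE2, nd_hyp|].
    assert (Bd : bounded 1 (bex_n (prefix sigma) (matrix sigma))).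
    { apply bex_n_bounded, bounded_mono with (prefix sigma + 0); [lia|].
      apply matrix_bounded, B. }
    assert (D := bex_n_Delta0 (prefix sigma) _ (matrix_Delta0 sigma Sg)).
    (* The base is [z + 2]. Index 1, which stood for [y], is reset to 0 since [n] may exceed the
       base; only index 0 is free in the formula. *)
    destruct (facts_Delta0 G n _ HG F D (2 + j) (env_cons j (fun _ => 0)))
      as [[H' _]|[_ H']].
    + lia.
    + intros [|v]; simpl; lia.
    + rewrite bex_n_size, matrix_size.
      eapply Nat.le_trans; [|exact L].
      apply tower_mono; [lia|apply form_size_godel].
    + exfalso; apply (T (env_cons j (fun _ => 0))); simpl.
      rewrite <- (ex_n_matrix sigma), N_sat_ex_n.
      apply N_sat_bex_n in H'; destruct H' as (xs & H1 & _ & H2); eauto.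
    + erewrite subst_ext_bounded; [exact H'| |exact Bd].
      intros [|k] Hk; [reflexivity|lia].
  - eapply nd_contra; [eapply nd_andE1, nd_hyp|exact Q].
Qed.

(** An axiom involves finitely many numbers, so [N] can be fixed before the context is known. *)
Lemma facts_R0 phi : R0 phi -> exists N, forall G, facts G N -> nd G phi.
Proof.
  intros [m n|m n|m n E|n|m n E].
  - exists (m + n); intros G F; apply (facts_add _ _ F); lia.
  - exists (m + n + m * n); intros G F; apply (facts_mul _ _ F); lia.
  - exists (m + n); intros G F; apply (facts_neq _ _ F); lia.
  - exists n; intros G F; apply (facts_bnd _ _ F); lia.
  - exists n; intros G F; apply (facts_le _ _ F); lia.
Qed.

Lemma cert_false sigma phi : Sigma1_sentence sigma -> N_models (fneg sigma) ->
  R0 phi -> nd [cert sigma] phi.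
Proof.
  intros Sg T R; destruct (facts_R0 phi R) as [N HN].
  assert (B := cert_matrix_bounded sigma (proj2 Sg)).
  eapply nd_exE; [apply nd_hyp|].
  unfold shift at 2; rewrite (subst_sentence _ phi (R0_sentence phi R)).
  set (G := _ :: _).
  assert (H : nd G (inst (tvar 0) (cert_matrix sigma))).
  { unfold inst; rewrite (subst_bounded 1); [apply nd_hyp| |exact B].
    intros [|k] Hk; [reflexivity|lia]. }
  assert (C : nd G (inst (tvar 0) certified)) by (eapply nd_andE1, H).
  apply (certified_cases (tvar 0) N phi G C).
  - intros n G' _ I Le E; apply nd_exfalso.
    (* The refutation is stated for the numeral; rewriting along [E] supplies its hypotheses from
       those about the eigenvariable. *)
    eapply nd_cut; [apply (cert_matrix_refuted sigma n Sg T)|].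
    intros p [<-|Hp].
    + eapply nd_eqE; [exact E|]; eapply nd_weak; [exact H|exact I].
    + apply in_map_iff in Hp; destruct Hp as (k & <- & Hk); apply in_seq in Hk.
      eapply nd_le_cong; [apply nd_refl|exact E|apply Le; lia].
  - intros G' I Le; apply HN.
    eapply certified_facts; [|exact Le].
    eapply nd_weak; [exact C|exact I].
Qed.

(** * Effectiveness *)

#[local] Opaque Cantor.to_nat Cantor.of_nat.

Definition computable (f : nat -> nat) : Prop :=
  exists c, forall n, rec_graph c n (f n).

Definition pi1 (n : nat) : nat := fst (Cantor.of_nat n).
Definition pi2 (n : nat) : nat := snd (Cantor.of_nat n).

Lemma pi1_pair a b : pi1 ⟨a, b⟩ = a.
Proof. unfold pi1; rewrite Cantor.cancel_of_to; reflexivity. Qed.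

Lemma pi2_pair a b : pi2 ⟨a, b⟩ = b.
Proof. unfold pi2; rewrite Cantor.cancel_of_to; reflexivity. Qed.

Lemma pi_pair n : ⟨pi1 n, pi2 n⟩ = n.
Proof.
  unfold pi1, pi2; rewrite <- surjective_pairing; apply Cantor.cancel_to_of.
Qed.

Lemma computable_ext f g : computable f -> (forall n, f n = g n) -> computable g.
Proof. intros [c H] E; exists c; intros n; rewrite <- E; apply H. Qed.

Lemma computable_comp f g : computable f -> computable g -> computable (fun n => f (g n)).
Proof. intros [c H] [d K]; exists (rcomp c d); intros n; simpl; eauto. Qed.

Lemma computable_pair f g :
  computable f -> computable g -> computable (fun n => ⟨f n, g n⟩).
Proof.
  intros [c H] [d K]; exists (rpair c d); intros n; exists (f n), (g n); auto.
Qed.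

Lemma computable_pi1 f : computable f -> computable (fun n => pi1 (f n)).
Proof. apply (computable_comp pi1); exists rfst; reflexivity. Qed.

Lemma computable_pi2 f : computable f -> computable (fun n => pi2 (f n)).
Proof. apply (computable_comp pi2); exists rsnd; reflexivity. Qed.

Lemma computable_succ f : computable f -> computable (fun n => S (f n)).
Proof. apply (computable_comp S); exists rsucc; reflexivity. Qed.

Lemma computable_const k : computable (fun _ => k).
Proof.
  induction k as [|k IH]; [exists rzero; reflexivity|apply computable_succ, IH].
Qed.

Lemma computable_id : computable (fun n => n).
Proof.
  eapply computable_ext; [|apply pi_pair].
  apply computable_pair; [exists rfst|exists rsnd]; reflexivity.
Qed.

(** The nested pairs follow the argument convention of [rprec]. *)
Lemma computable_prec f g h k :
  computable f -> computable g -> computable h -> computable k ->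
  computable (fun n => nat_rec (fun _ => nat) (f (h n))
    (fun i w => g ⟨h n, ⟨i, w⟩⟩) (k n)).
Proof.
  intros [c Hc] [d Hd] Hh Hk.
  destruct (computable_pair h k Hh Hk) as [e He].
  exists (rcomp (rprec c d) e); intros n; exists ⟨h n, k n⟩; split; [apply He|].
  simpl; rewrite Cantor.cancel_of_to.
  induction (k n) as [|i IH]; [apply Hc|].
  eexists; split; [exact IH|apply Hd].
Qed.

Lemma computable_iter step init count :
  computable step -> computable init -> computable count ->
  computable (fun n => Nat.iter (count n) step (init n)).
Proof.
  intros Hs Hi Hc.
  eapply computable_ext.
  - apply (computable_prec (fun n => n) (fun p => step (pi2 (pi2 p))) init count);
      auto using computable_id.
    apply (computable_comp step); auto using computable_pi2, computable_id.
  - intros n; simpl; induction (count n) as [|i IH]; simpl; [reflexivity|].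
    rewrite !pi2_pair, IH; reflexivity.
Qed.

(** Case distinction is a primitive recursion whose step ignores the previous value. *)
Lemma computable_if_zero f g k : computable f -> computable g -> computable k ->
  computable (fun n => match k n with 0 => f n | S _ => g n end).
Proof.
  intros Hf Hg Hk.
  eapply computable_ext.
  - apply (computable_prec f (fun p => g (pi1 p)) (fun n => n) k); auto using computable_id.
    apply (computable_comp g); auto using computable_pi1, computable_id.
  - intros n; simpl; destruct (k n); simpl; rewrite ?pi1_pair; reflexivity.
Qed.

Lemma computable_pred f : computable f -> computable (fun n => Nat.pred (f n)).
Proof.
  intros Hf; eapply computable_ext.
  - apply (computable_prec (fun _ => 0) (fun p => pi1 (pi2 p)) f f);
      auto using computable_const, computable_pi1, computable_pi2, computable_id.
  - intros n; simpl; destruct (f n); simpl; rewrite ?pi2_pair, ?pi1_pair; reflexivity.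
Qed.

Create HintDb computable.
#[local] Hint Resolve computable_pair computable_pi1 computable_pi2 computable_succ
  computable_const computable_id computable_iter computable_if_zero computable_pred
  : computable.

(* Gödel numbers of formulas have first component at most 7, so being positive
   after six predecessors recognises the code of [fex]. *)
Definition strip_step (p : nat) : nat :=
  match Nat.iter 6 Nat.pred (pi1 (pi1 p)) with
  | 0 => p
  | S _ => ⟨pi2 (pi1 p), S (pi2 p)⟩
  end.

(** On a pair of a code and a positive counter [m], adds one layer of [bex_n]; [S (Nat.pred m)] is
    the shifted index of the bound [tvar (m - 1)]. *)
Definition wrap_step (p : nat) : nat :=
  ⟨⟨7, ⟨4, ⟨⟨2, ⟨godel_term (tvar 0), ⟨0, S (Nat.pred (pi2 p))⟩⟩⟩, pi1 p⟩⟩⟩, Nat.pred (pi2 p)⟩.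

(** Carries the codes of [square_term d] and [squares_le d] together. The tag 4 codes [tmul] in
    terms and [fand] in formulas. *)
Definition square_step (p : nat) : nat :=
  ⟨⟨4, ⟨pi1 p, pi1 p⟩⟩,
   ⟨4, ⟨pi2 p, ⟨2, ⟨⟨4, ⟨pi1 p, pi1 p⟩⟩, godel_term (tvar 1)⟩⟩⟩⟩⟩.

Lemma strip_step_computable : computable strip_step.
Proof.
  unfold strip_step; simpl Nat.iter; auto 20 with computable.
Qed.

Lemma wrap_step_computable : computable wrap_step.
Proof. unfold wrap_step; auto 20 with computable. Qed.

Lemma square_step_computable : computable square_step.
Proof. unfold square_step; auto 20 with computable. Qed.

Lemma strip_step_fex phi m : strip_step ⟨godel (fex phi), m⟩ = ⟨godel phi, S m⟩.
Proof.
  unfold strip_step; cbn [godel]; rewrite !pi1_pair, !pi2_pair; reflexivity.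
Qed.

Lemma strip_step_matrix phi m :
  strip_step ⟨godel (matrix phi), m⟩ = ⟨godel (matrix phi), m⟩.
Proof.
  unfold strip_step.
  induction phi; cbn [matrix]; auto; cbn [godel]; rewrite !pi1_pair; reflexivity.
Qed.

(** The matrix is a fixed point of [strip_step], so surplus steps are idle and any upper bound on
    the prefix will do, such as the code itself. *)
Lemma strip_iter phi : forall k m, prefix phi <= k ->
  Nat.iter k strip_step ⟨godel phi, m⟩ = ⟨godel (matrix phi), m + prefix phi⟩.
Proof.
  assert (St : forall phi k m, Nat.iter k strip_step ⟨godel (matrix phi), m⟩
    = ⟨godel (matrix phi), m⟩).
  { intros psi k m; induction k as [|k IH]; simpl; [reflexivity|].
    rewrite IH; apply strip_step_matrix. }
  induction phi as [| | | | | | |phi IH]; intros k m Hk;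
    try (cbn [prefix]; rewrite Nat.add_0_r;
         match goal with |- _ = ⟨godel (matrix ?p), _⟩ => exact (St p k m) end).
  cbn [prefix matrix] in *; destruct k as [|k]; [lia|].
  rewrite Nat.iter_succ_r, strip_step_fex, IH by lia.
  f_equal; f_equal; lia.
Qed.

Lemma wrap_iter m : forall phi,
  Nat.iter m wrap_step ⟨godel phi, m⟩ = ⟨godel (bex_n m phi), 0⟩.
Proof.
  induction m as [|m IH]; intros phi; [reflexivity|].
  rewrite Nat.iter_succ_r; simpl bex_n; rewrite <- IH; f_equal.
  unfold wrap_step; rewrite pi1_pair, pi2_pair; reflexivity.
Qed.

Lemma square_iter d :
  Nat.iter d square_step ⟨godel_term (square_term 0), godel (squares_le 0)⟩
  = ⟨godel_term (square_term d), godel (squares_le d)⟩.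
Proof.
  induction d as [|d IH]; [reflexivity|].
  change (Nat.iter (S d) ?f ?x) with (f (Nat.iter d f x)); rewrite IH.
  unfold square_step; rewrite pi1_pair, pi2_pair; reflexivity.
Qed.

Lemma prefix_godel phi : prefix phi <= godel phi.
Proof.
  induction phi; cbn [prefix]; auto using Nat.le_0_l; cbn [godel].
  pose proof (Cantor.to_nat_non_decreasing 7 (godel phi)); lia.
Qed.

(** The code is peeled to its matrix while quantifiers are counted, rewrapped with bounded ones, and
    joined to the iterated squares. This works on the code of every formula, hence on any [D]. *)
Lemma cert_effective D : effective_on D cert.
Proof.
  set (strip n := Nat.iter n strip_step ⟨n, 0⟩).
  set (wrap n := pi1 (Nat.iter (pi2 (strip n)) wrap_step (strip n))).
  set (squares n := pi2 (Nat.iter n square_step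
    ⟨godel_term (square_term 0), godel (squares_le 0)⟩)).
  assert (Hs : computable strip)
    by (unfold strip; auto using strip_step_computable with computable).
  assert (Hw : computable wrap)
    by (unfold wrap; auto using wrap_step_computable with computable).
  assert (Hq : computable squares)
    by (unfold squares; auto using square_step_computable with computable).
  (* Mirrors [cert]: the tags 7 and 4 code [fex] and [fand], and [tvar 1] is the bound [y] seen from
     under the quantifier on [z]. *)
  assert (H : computable (fun n => ⟨7, ⟨4, ⟨godel certified, ⟨7, ⟨4,
    ⟨godel (fle (tvar 0) (tvar 1)), ⟨4, ⟨squares n, wrap n⟩⟩⟩⟩⟩⟩⟩⟩))
    by auto 20 with computable.
  destruct H as [c Hc]; exists c; intros phi _.
  assert (Es : squares (godel phi) = godel (squares_le (godel phi)))
    by (unfold squares; rewrite square_iter, pi2_pair; reflexivity).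
  assert (Ew : wrap (godel phi) = godel (bex_n (prefix phi) (matrix phi))).
  { unfold wrap, strip; rewrite strip_iter by apply prefix_godel.
    cbn [Nat.add]; rewrite pi2_pair, wrap_iter, pi1_pair; reflexivity. }
  specialize (Hc (godel phi)); cbv beta in Hc; rewrite Es, Ew in Hc; exact Hc.
Qed.

Theorem theorem2p9 :
  exists cert : form -> form,
    effective_on Sigma1_sentence cert /\
    forall sigma : form, Sigma1_sentence sigma ->
      sentence (cert sigma) /\
      proves (single (cert sigma)) sigma /\
      (N_models sigma -> proves R0 (cert sigma)) /\
      (N_models (fneg sigma) -> proves_theory (single (cert sigma)) R0).
Proof.
  exists cert; split; [apply cert_effective|].
  intros sigma Sg; split; [|split; [|split]].
  - apply cert_matrix_bounded, Sg.
  - exists [cert sigma]; split; [intros psi [<-|[]]; reflexivity|].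
    apply cert_implies, Sg.
  - apply cert_true, Sg.
  - intros T psi R; exists [cert sigma]; split; [intros p [<-|[]]; reflexivity|].
    apply cert_false; assumption.
Qed.
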